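(* Let $\overline B$ be a subdiagram of a Bratteli diagram $B$ such that $X_{\overline B}$ is a thin subset of $X_B$. Then for any probability $\overline{\mathcal E}$-invariant measure $\overline \mu$ on $X_{\overline B}$ we have $\widehat{\overline{\mu}}(\widehat X_{\overline B}) = \infty$.
   Context: A Bratteli diagram $B=(V,E)$ is an infinite graph with $V=\bigcup_{i\ge 0}V_i$, $E=\bigcup_{i\ge1}E_i$ (disjoint finite levels, $V_0=\{v_0\}$), with range and source maps $r,s$ on edges such that $r(E_i)=V_i$, $s(E_i)=V_{i-1}$, $s^{-1}(v)\ne\emptyset$ for all $v$, and $r^{-1}(v)\neq\emptyset$ for all $v\ne v_0$. $X_B$ is the space of infinite paths starting at $v_0$ with the cylinder topology, assumed to be a Cantor set. Two paths are tail equivalent, $(x,y)\in\mathcal E$, if they agree from some index on. A measure is $\mathcal E$-invariant if any two cylinder sets given by finite paths from $v_0$ to the same vertex have equal measure. A subdiagram $\overline B=(\overline V,\overline E)$ consists of subsets $\overline V\subset V$, $\overline E\subset E$ with $\overline V=s(\overline E)$ and $s(\overline E)=r(\overline E)\cup\{v_0\}$. $X_{\overline B}\subset X_B$ is its set of infinite paths and $\overline{\mathcal E}$ is the tail equivalence relation on $X_{\overline B}$. The set $X_{\overline B}$ is thin if $\mu(X_{\overline B})=0$ for every ergodic $\mathcal E$-invariant probability measure $\mu$ on $X_B$. $\widehat X_{\overline B}=\mathcal E(X_{\overline B})$ is the set of all paths in $X_B$ tail equivalent to some path of $X_{\overline B}$. $\widehat{\overline\mu}$ is the unique extension of $\overline\mu$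 to an $\mathcal E$-invariant Borel measure (finite or infinite) on $\widehat X_{\overline B}$: if $\overline f$ is a finite path in $B$ from $v_0$ to a vertex $v$ of $\overline B$ at level $n$, then the set of paths with initial segment $\overline f$ and tail (all edges after level $n$) in $\overline B$ has the same measure as the cylinder in $X_{\overline B}$ of any finite path of $\overline B$ from $v_0$ to $v$. *)

(* Defs.v *)
From HB Require Import structures.
From mathcomp Require Import all_boot all_order all_algebra.
From mathcomp Require Import zify.
From mathcomp Require Import all_classical all_reals all_analysis.

Set Implicit Arguments.
Unset Strict Implicit.
Unset Printing Implicit Defensive.

Local Open Scope classical_set_scope.

(* Levels are indexed from 0: [vert n] is V_n, but [edge n] is E_(n+1), the
   set of edges from V_n to V_(n+1). *)
Record bratteli := Bratteli {
  vert : nat -> finType;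
  edge : nat -> finType;
  src : forall n, edge n -> vert n;
  rng : forall n, edge n -> vert n.+1;
  vroot : vert 0;
  vrootP : forall v : vert 0, v = vroot;
  src_surj : forall n (v : vert n), exists e : edge n, src e = v;
  rng_surj : forall n (v : vert n.+1), exists e : edge n, rng e = v }.

Arguments src {b n}.
Arguments rng {b n}.

Notation edge_seq B := (forall i, edge B i).

(* Infinite paths from the root; they start at the root since V_0 = {vroot}. *)
Record inf_path (B : bratteli) := Path {
  path_edge :> edge_seq B;
  path_chain : forall i, rng (path_edge i) = src (path_edge i.+1) }.

(* A finite path of length n from the root is encoded by any sequence of edges
   whose first n entries form the path; the later entries are irrelevant. *)
Definition fin_path (B : bratteli) (n : nat) (f : edge_seq B) : Prop :=
  forall i, (i.+1 < n)%N -> rng (f i) = src (f i.+1).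

Definition endpoint (B : bratteli) (f : edge_seq B) (n : nat) : vert B n :=
  match n with 0 => vroot B | m.+1 => rng (f m) end.

Definition fin_path_to (B : bratteli) (n : nat) (v : vert B n) (f : edge_seq B) :=
  fin_path n f /\ endpoint f n = v.

Definition cylinder (B : bratteli) (n : nat) (f : edge_seq B) : set (inf_path B) :=
  [set x : inf_path B | forall i, (i < n)%N -> x i = f i].

Definition tail_equiv (B : bratteli) (x y : inf_path B) : Prop :=
  exists N, forall i, (N <= i)%N -> x i = y i.

(* The topology with the cylinders as a base. *)
Definition path_open (B : bratteli) (A : set (inf_path B)) : Prop :=
  forall x, A x -> exists n, cylinder n x `<=` A.

Section path_topology.
Variable B : bratteli.

Let path_openT : path_open [set: inf_path B].
Proof. by move=> x _; exists 0. Qed.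

Let path_openI : setI_closed (@path_open B).
Proof.
move=> A C oA oC x [Ax Cx]; have [n nA] := oA _ Ax; have [m mC] := oC _ Cx.
exists (maxn n m) => y xy; split; [apply: nA|apply: mC] => i im; apply: xy.
  by rewrite leq_max im.
by rewrite leq_max im orbT.
Qed.

Let path_open_bigU (I : Type) (F : I -> set (inf_path B)) :
  (forall i, path_open (F i)) -> path_open (\bigcup_i F i).
Proof.
move=> oF x [i _ Fix]; have [n nF] := oF i x Fix.
by exists n => y /nF; exists i.
Qed.

HB.instance Definition _ := gen_eqMixin (inf_path B).
HB.instance Definition _ := gen_choiceMixin (inf_path B).
HB.instance Definition _ :=
  isOpenTopological.Build (inf_path B) path_openT path_openI path_open_bigU.

Lemma path_exists (P : forall n, set (edge B n)) :
  P 0 !=set0 ->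
  (forall n e, P n e -> exists2 e', P n.+1 e' & src e' = rng e) ->
  exists x : inf_path B, forall n, P n (x n).
Proof.
move=> /cid[e0 Pe0] step.
have nxt n (u : {e | P n e}) :
    {u' : {e | P n.+1 e} | src (sval u') = rng (sval u)}.
  by have [e' Pe' se'] := cid2 (step n _ (svalP u)); exists (exist _ e' Pe').
pose fix s n : {e | P n e} :=
  if n is m.+1 then sval (nxt m (s m)) else exist _ e0 Pe0.
have ch i : rng (sval (s i)) = src (sval (s i.+1)).
  by rewrite /= (svalP (nxt i (s i))).
by exists (Path ch) => n; exact: svalP.
Qed.

Lemma path_inhabited : exists x : inf_path B, True.
Proof.
have [] := @path_exists (fun=> setT).
- by have [e] := src_surj (vroot B); exists e.
- by move=> n e _; have [e'] := src_surj (rng e); exists e'.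
- by move=> x; exists x.
Qed.

HB.instance Definition _ := isPointed.Build (inf_path B) (projT1 (cid path_inhabited)).

End path_topology.

(* [sub_src0] and [sub_srcS] split s(E') = r(E') U {v_0} by level. *)
Record subdiagram (B : bratteli) := Subdiagram {
  subV : forall n, {set vert B n};
  subE : forall n, {set edge B n};
  subV_src : forall n, subV n = [set src e | e in subE n]%SET;
  sub_src0 : ([set src e | e in subE 0] = [set vroot B])%SET;
  sub_srcS : forall n,
    [set src e | e in subE n.+1]%SET = [set rng e | e in subE n]%SET }.

Definition sub_paths (B : bratteli) (S : subdiagram B) : set (inf_path B) :=
  [set x : inf_path B | forall i, x i \in subE S i].

Definition hat_paths (B : bratteli) (S : subdiagram B) : set (inf_path B) :=
  [set x : inf_path B | exists2 y, sub_paths S y & tail_equiv x y].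

Lemma subV0 (B : bratteli) (S : subdiagram B) : subV S 0 = [set vroot B]%SET.
Proof. by rewrite subV_src sub_src0. Qed.

Lemma subVS (B : bratteli) (S : subdiagram B) n :
  subV S n.+1 = [set rng e | e in subE S n]%SET.
Proof. by rewrite subV_src sub_srcS. Qed.

Lemma sub_paths_inhabited (B : bratteli) (S : subdiagram B) :
  exists x : inf_path B, sub_paths S x.
Proof.
apply: (@path_exists B (fun n => [set e | e \in subE S n])).
- have: vroot B \in [set src e | e in subE S 0]%SET by rewrite sub_src0 inE.
  by case/imsetP => e eS _; exists e.
- move=> n e /= eS; have: rng e \in [set rng e | e in subE S n]%SET.
    exact: imset_f.
  by rewrite -sub_srcS => /imsetP[e' e'S e'E]; exists e'.
Qed.

(* X_Bbar and its saturation as topological spaces in their own right, with the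
   topology induced by X_B. *)
Definition sub_space (B : bratteli) (S : subdiagram B) : Type :=
  set_type (sub_paths S).

Definition hat_space (B : bratteli) (S : subdiagram B) : Type :=
  set_type (hat_paths S).

Section spaces.
Variables (B : bratteli) (S : subdiagram B).

Let sub_point : sub_space S.
Proof.
have [x Sx] := cid (sub_paths_inhabited S); exists x; exact: mem_set.
Defined.

Let hat_point : hat_space S.
Proof.
have [x Sx] := cid (sub_paths_inhabited S); exists x; apply: mem_set.
by exists x => //; exists 0.
Defined.

HB.instance Definition _ := Topological.on (sub_space S).
HB.instance Definition _ := isPointed.Build (sub_space S) sub_point.
HB.instance Definition _ := Topological.on (hat_space S).
HB.instance Definition _ := isPointed.Build (hat_space S) hat_point.

End spaces.

Definition sub_val (B : bratteli) (S : subdiagram B) : sub_space S -> inf_path B :=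
  @set_val _ (sub_paths S).

Definition hat_val (B : bratteli) (S : subdiagram B) : hat_space S -> inf_path B :=
  @set_val _ (hat_paths S).

Arguments sub_val {B} S.
Arguments hat_val {B} S.

Notation borel T := (g_sigma_algebraType (@open T)).

Definition sub_fin_path_to (B : bratteli) (S : subdiagram B) (n : nat)
    (v : vert B n) (f : edge_seq B) : Prop :=
  fin_path_to v f /\ forall i, (i < n)%N -> f i \in subE S i.

Local Open Scope ring_scope.
Local Open Scope ereal_scope.

Section invariance.
Variables (R : realType) (B : bratteli) (S : subdiagram B).

Definition tail_invariant (mu : {measure set (borel (inf_path B)) -> \bar R}) : Prop :=
  forall n (v : vert B n) f g, fin_path_to v f -> fin_path_to v g ->
    mu (cylinder n f) = mu (cylinder n g).

Definition sub_invariant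
    (mu : {measure set (borel (sub_space S)) -> \bar R}) : Prop :=
  forall n (v : vert B n) f g, sub_fin_path_to S v f -> sub_fin_path_to S v g ->
    mu (sub_val S @^-1` cylinder n f) = mu (sub_val S @^-1` cylinder n g).

Definition hat_invariant
    (nu : {measure set (borel (hat_space S)) -> \bar R}) : Prop :=
  forall n (v : vert B n) f g, fin_path_to v f -> fin_path_to v g ->
    nu (hat_val S @^-1` cylinder n f) = nu (hat_val S @^-1` cylinder n g).

Definition ergodic (mu : {measure set (borel (inf_path B)) -> \bar R}) : Prop :=
  forall A : set (borel (inf_path B)), measurable A ->
    (forall x y, tail_equiv x y -> A x -> A y) -> mu A = 0 \/ mu A = 1.

Definition thin : Prop :=
  forall mu : probability (borel (inf_path B)) R,
    tail_invariant mu -> ergodic mu -> mu (sub_paths S) = 0.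

(* All edges after level n lie in the subdiagram. *)
Definition tail_in (n : nat) : set (inf_path B) :=
  [set x : inf_path B | forall i, (n <= i)%N -> x i \in subE S i].

(* [nu] is the extension of [mu] to a tail-invariant measure, possibly infinite,
   on the saturation.  [hat_extension_cylinder] alone determines it, the sets
   [cylinder n f `&` tail_in n] being countably many and generating; it exists
   by [hat_extension_exists]. *)
Record hat_extension (mu : {measure set (borel (sub_space S)) -> \bar R})
    (nu : {measure set (borel (hat_space S)) -> \bar R}) : Prop := {
  hat_extends : forall A : set (borel (inf_path B)), measurable A ->
    nu (hat_val S @^-1` (A `&` sub_paths S)) = mu (sub_val S @^-1` A);
  hat_extension_invariant : hat_invariant nu;
  hat_extension_cylinder : forall n (v : vert B n) f g,
    v \in subV S n -> fin_path_to v f -> sub_fin_path_to S v g ->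
    nu (hat_val S @^-1` (cylinder n f `&` tail_in n)) =
    mu (sub_val S @^-1` cylinder n g) }.

End invariance.

Section hat_extension_exists.
Variables (R : realType) (B : bratteli) (S : subdiagram B).

Let open_cylinder n (f : edge_seq B) : open (cylinder n f).
Proof. by move=> x xf; exists n => y yx i im; rewrite yx// xf. Qed.

Let measurable_cylinder n (f : edge_seq B) :
  measurable (cylinder n f : set (borel (inf_path B))).
Proof. by apply: sub_sigma_algebra; exact: open_cylinder. Qed.

Let measurable_tail_in n : measurable (tail_in S n : set (borel (inf_path B))).
Proof.
rewrite -[tail_in S n]setCK; apply: measurableC; apply: sub_sigma_algebra.
move=> x /existsNP[i] /not_implyP[ni xi]; exists i.+1 => y yx yt.
by apply: xi; rewrite -yx// yt.
Qed.

Let measurable_sub_val : measurable_fun [set: borel (sub_space S)]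
  (sub_val S : _ -> borel (inf_path B)).
Proof.
apply: (@measurability _ _ (borel (sub_space S)) (borel (inf_path B)) _
  (sub_val S) (@open (inf_path B))) => //.
move=> _ [A oA <-]; rewrite setTI; apply: sub_sigma_algebra; by exists A.
Qed.

Let measurable_hat_val : measurable_fun [set: borel (hat_space S)]
  (hat_val S : _ -> borel (inf_path B)).
Proof.
apply: (@measurability _ _ (borel (hat_space S)) (borel (inf_path B)) _
  (hat_val S) (@open (inf_path B))) => //.
move=> _ [A oA <-]; rewrite setTI; apply: sub_sigma_algebra; by exists A.
Qed.

Let measurable_sub (A : set (borel (inf_path B))) : measurable A ->
  measurable (sub_val S @^-1` A : set (borel (sub_space S))).
Proof. by move=> mA; rewrite -[X in measurable X]setTI; exact: measurable_sub_val. Qed.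

Let measurable_hat (A : set (borel (inf_path B))) : measurable A ->
  measurable (hat_val S @^-1` A : set (borel (hat_space S))).
Proof. by move=> mA; rewrite -[X in measurable X]setTI; exact: measurable_hat_val. Qed.

Let subP (y : sub_space S) : sub_paths S (sub_val S y).
Proof. by case: y => y yS; exact: set_mem yS. Qed.

Let endpoint_sub (f : edge_seq B) n :
  (forall i, (i < n)%N -> f i \in subE S i) -> endpoint f n \in subV S n.
Proof.
case: n => [|n] fS; first by rewrite subV0 inE.
by rewrite subVS; apply: imset_f; exact: fS.
Qed.

Let endpoint_src (x : inf_path B) n : endpoint x n = src (x n).
Proof. by case: n => [|n] /=; [rewrite [RHS]vrootP|rewrite path_chain]. Qed.

Let sub_fin_path_exists n (v : vert B n) : v \in subV S n ->
  exists f, sub_fin_path_to S v f.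
Proof.
move=> vS.
have: exists f, [/\ fin_path n f, endpoint f n = v &
    forall i, (i < n)%N -> f i \in subE S i].
  elim: n v vS => [|n IH] v.
    move=> _; exists (point : inf_path B); split => //.
    by rewrite [LHS]vrootP [RHS]vrootP.
  rewrite subVS => /imsetP[e eS ->].
  have /IH[f [ff fe fS]]: src e \in subV S n by rewrite subV_src imset_f.
  exists (dfwith f n e); split.
  - move=> i; rewrite ltnS leq_eqVlt => /predU1P[E|im].
      subst n; rewrite dfwithin dfwithout//; last by apply/eqP; lia.
    by rewrite !dfwithout ?ff//; apply/eqP; lia.
  - by rewrite /= dfwithin.
  - move=> i; rewrite ltnS leq_eqVlt => /predU1P[E|im].
      by subst n; rewrite dfwithin.
    by rewrite dfwithout ?fS//; apply/eqP; lia.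
by move=> [f [? ? ?]]; exists f; split.
Qed.


Let splice n (f x : edge_seq B) : edge_seq B :=
  fun i => if (i < n)%N then f i else x i.

Let spliceable n (f : edge_seq B) (x : inf_path B) :=
  fin_path n f /\ endpoint f n = endpoint x n.

Let splice_chain n f x : spliceable n f x ->
  forall i, rng (splice n f x i) = src (splice n f x i.+1).
Proof.
move=> [ff fx] i; rewrite /splice; case: (ltngtP i.+1 n) => [im|ni|ni].
- exact: ff.
- exact: path_chain.
- by move: fx; rewrite -ni endpoint_src.
Qed.

Let splice_hat n f (y : sub_space S) (H : spliceable n f (sub_val S y)) :
  Path (splice_chain H) \in hat_paths S.
Proof.
apply: mem_set; exists (sub_val S y); first exact: subP.
by exists n => i ni /=; rewrite /splice ltnNge ni.
Qed.

Let graft n f (y : sub_space S) : hat_space S :=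
  if pselect (spliceable n f (sub_val S y)) is left H
  then exist (fun x => x \in hat_paths S) _ (splice_hat H) else point.

Let graftE n f y : spliceable n f (sub_val S y) ->
  hat_val S (graft n f y) = splice n f (sub_val S y) :> (edge_seq B).
Proof. by rewrite /graft; case: pselect. Qed.

Let eq_endpoint (f g : edge_seq B) n : (forall i, (i < n)%N -> f i = g i) ->
  endpoint f n = endpoint g n.
Proof. by case: n => //= n -> //. Qed.

Let measurable_graft n f :
  measurable_fun [set: borel (sub_space S)] (graft n f : _ -> borel (hat_space S)).
Proof.
apply: (@measurability _ _ (borel (sub_space S)) (borel (hat_space S)) _
  (graft n f) (@open (hat_space S))) => //.
move=> _ [U [A oA <-] <-]; rewrite setTI; apply: sub_sigma_algebra.
exists [set x : inf_path B | exists2 m, (n <= m)%N & forall y,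
    cylinder m x (sub_val S y) -> A (hat_val S (graft n f y))].
  move=> x [m nm xm]; exists m => x' xx'; exists m => // y yx'.
  by apply: xm => i im; rewrite yx'// xx'.
apply/seteqP; split => y /=; first by move=> [m _ /(_ y)]; apply.
move=> /oA[m mA]; exists (maxn n m); first exact: leq_maxl.
move=> y' yy'; apply: mA => i im.
have E : endpoint (sub_val S y') n = endpoint (sub_val S y) n.
  by apply: eq_endpoint => j jn; apply: yy'; rewrite leq_max jn.
have [H|H] := pselect (spliceable n f (sub_val S y)).
  have H' : spliceable n f (sub_val S y') by move: H; rewrite /spliceable E.
  rewrite !graftE// /splice; case: ifP => // _.
  by apply: yy'; rewrite leq_max im orbT.
have H' : ~ spliceable n f (sub_val S y') by move: H; rewrite /spliceable E.
by rewrite /graft; case: pselect => // _; case: pselect.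
Qed.

Variable mu : {measure set (borel (sub_space S)) -> \bar R}.

Let measurable_graft_set n f g (A : set (borel (hat_space S))) : measurable A ->
  measurable (sub_val S @^-1` cylinder n g `&` graft n f @^-1` A
    : set (borel (sub_space S))).
Proof.
move=> mA; apply: measurableI; first exact: measurable_sub.
by rewrite -[X in measurable X]setTI; exact: measurable_graft.
Qed.

Definition graft_measure n (f g : edge_seq B)
    (A : set (borel (hat_space S))) : \bar R :=
  mu (sub_val S @^-1` cylinder n g `&` graft n f @^-1` A).

Section graft_measure.
Variables (n : nat) (f g : edge_seq B).

Let graft_measure0 : graft_measure n f g set0 = 0.
Proof. by rewrite /graft_measure preimage_set0 setI0 measure0. Qed.

Let graft_measure_ge0 A : 0 <= graft_measure n f g A.
Proof. exact: measure_ge0. Qed.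

Let graft_measure_additive : semi_sigma_additive (graft_measure n f g).
Proof.
move=> F mF tF mUF; rewrite /graft_measure preimage_bigcup setI_bigcupr.
apply: measure_semi_sigma_additive.
- by move=> k; exact: measurable_graft_set.
- apply/trivIsetP => /= i j _ _ ij; apply/seteqP; split => y //=.
  move=> [[_ Fi] [_ Fj]]; move/trivIsetP : tF => /(_ _ _ Logic.I Logic.I ij).
  move=> Fij0; have : (F i `&` F j) (graft n f y) by [].
  by rewrite Fij0.
- by rewrite -setI_bigcupr -preimage_bigcup; exact: measurable_graft_set.
Qed.

HB.instance Definition _ := isMeasure.Build _ _ _ (graft_measure n f g)
  graft_measure0 graft_measure_ge0 graft_measure_additive.

End graft_measure.

Let fin_code := {n : nat & {dffun forall i : 'I_n, edge B i}}.

Let fin_seq (t : fin_code) : edge_seq B := fun i =>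
  if @idP (i < tag t)%N is ReflectT H then tagged t (Ordinal H)
  else (point : inf_path B) i.

Let fin_seq_of n (f : edge_seq B) : fin_code :=
  Tagged (fun n => {dffun forall i : 'I_n, edge B i}) [ffun i : 'I_n => f i].

Let fin_seq_ofE n f i : (i < n)%N -> fin_seq (fin_seq_of n f) i = f i.
Proof.
move=> im; rewrite /fin_seq /=; case: {-}_ / idP => [H|//].
by rewrite ffunE.
Qed.

Let fin_seqK t : fin_seq_of (tag t) (fin_seq t) = t.
Proof.
case: t => n h; congr Tagged; apply/ffunP => -[i im]; rewrite ffunE /fin_seq /=.
by case: {-}_ / idP => [H|//]; rewrite (bool_irrelevance H im).
Qed.

Let eq_fin_seq_of n (f g : edge_seq B) :
  (forall i, (i < n)%N -> f i = g i) -> fin_seq_of n f = fin_seq_of n g.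
Proof. by move=> fg; congr Tagged; apply/ffunP => i; rewrite !ffunE fg. Qed.

Let reduced n (f : edge_seq B) :=
  [/\ fin_path n f, endpoint f n \in subV S n &
      forall m, n = m.+1 -> f m \notin subE S m].

Let reduced_exists n f (H : reduced n f) :
  exists g, sub_fin_path_to S (endpoint f n) g.
Proof. by case: H => _ + _; exact: sub_fin_path_exists. Qed.

Let code_measure (t : fin_code) : {measure set (borel (hat_space S)) -> \bar R} :=
  if pselect (reduced (tag t) (fin_seq t)) is left H
  then graft_measure (tag t) (fin_seq t) (sval (cid (reduced_exists H)))
  else mzero.

Let hat_measure : {measure set (borel (hat_space S)) -> \bar R} :=
  mseries (fun k => if pickle_inv k is Some t then code_measure t else mzero) 0.

Let hat_measure_single t A : (forall t', t' <> t -> code_measure t' A = 0) ->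
  hat_measure A = code_measure t A.
Proof.
move=> tA; rewrite /hat_measure/= /mseries (@nneseriesD1 _ _ (pickle t))//.
rewrite pickleK_inv eseries0 ?adde0// => k _ kt.
case E : (pickle_inv k) => [t'|//]; apply: tA => tt'.
move/negP : kt; apply; rewrite -tt'.
by have := @pickle_invK fin_code k; rewrite E /= => ->.
Qed.

Let cylinder_spliceable n (f g : edge_seq B) (y : inf_path B) :
  fin_path n f -> sub_fin_path_to S (endpoint f n) g -> cylinder n g y ->
  spliceable n f y.
Proof.
move=> ff [[_ gf] _] gy; split => //; rewrite -gf.
by apply: eq_endpoint => i im; rewrite gy.
Qed.

Let code_measureE t A : reduced (tag t) (fin_seq t) ->
  exists2 g, sub_fin_path_to S (endpoint (fin_seq t) (tag t)) g &
    code_measure t A = mu (sub_val S @^-1` cylinder (tag t) g `&`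
                           graft (tag t) (fin_seq t) @^-1` A).
Proof.
move=> H; rewrite /code_measure; case: pselect => // {}H.
by case: cid => g gP; exists g.
Qed.

Let code_measure0 t A :
  (reduced (tag t) (fin_seq t) -> forall y,
     spliceable (tag t) (fin_seq t) (sub_val S y) ->
     ~ A (graft (tag t) (fin_seq t) y)) ->
  code_measure t A = 0.
Proof.
move=> tA; have [H|H] := pselect (reduced (tag t) (fin_seq t)); last first.
  by rewrite /code_measure; case: pselect.
have [g gP ->] := code_measureE A H.
rewrite (_ : _ `&` _ = set0) ?measure0//; apply/seteqP; split => y //= [gy].
by apply: tA => //; apply: cylinder_spliceable gy => //; case: H.
Qed.

Hypothesis mu_inv : sub_invariant mu.

Let fin_path_src n (f : edge_seq B) m : fin_path n f -> (m < n)%N ->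
  endpoint f m = src (f m).
Proof. by case: m => [|m] ff mn /=; [rewrite [RHS]vrootP|exact: ff]. Qed.

Let eq_endpoint_gt (f g : edge_seq B) p n : (p < n)%N ->
  (forall i, (p <= i)%N -> f i = g i) -> endpoint f n = endpoint g n.
Proof. by case: n => //= n; rewrite ltnS => pn ->. Qed.

Let hat_measure_cylinder n (v : vert B n) f g :
  v \in subV S n -> fin_path_to v f -> sub_fin_path_to S v g ->
  hat_measure (hat_val S @^-1` (cylinder n f `&` tail_in S n)) =
  mu (sub_val S @^-1` cylinder n g).
Proof.
move=> vS [ff fv] gv.
pose P p := (p <= n)%N && [forall i : 'I_n, (p <= i)%N ==> (f i \in subE S i)].
have exP : exists p, P p.
  exists n; rewrite /P leqnn; apply/forallP => i.
  by rewrite leqNgt ltn_ord.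
case: (ex_minnP exP) => p /andP[pn /forallP Pp] pmin.
have {}Pp i : (p <= i)%N -> (i < n)%N -> f i \in subE S i.
  by move=> pi im; have /implyP := Pp (Ordinal im); exact.
pose t0 := fin_seq_of p f.
have t0E i : (i < p)%N -> fin_seq t0 i = f i by exact: fin_seq_ofE.
have et0 : endpoint (fin_seq t0) p = endpoint f p by exact: eq_endpoint.
have redt0 : reduced (tag t0) (fin_seq t0).
  split => /=.
  - move=> i ip; rewrite !t0E//; last exact: ltnW.
    by apply: ff; exact: leq_trans ip _.
  - rewrite et0; move: pn; rewrite leq_eqVlt => /predU1P[pE|pn].
      by move: Pp pmin t0 t0E et0 => _ _ _ _ _; subst p; rewrite fv.
    by rewrite (fin_path_src ff pn) subV_src imset_f// Pp.
  - move=> m pE; rewrite t0E ?pE//; apply/negP => fm.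
    suff : P m by move=> /pmin; rewrite pE ltnn.
    rewrite /P (leq_trans _ pn) ?pE//=; apply/forallP => i; apply/implyP.
    rewrite leq_eqVlt => /predU1P[<-//|mi]; apply: Pp => //.
    by rewrite pE.
rewrite (@hat_measure_single t0); last first.
  move=> t tt0; apply: code_measure0 => -[_ _ red] y spl [xf xt].
  set q := tag t in red spl *.
  have xE := graftE spl; rewrite /= in xf xt.
  have qn : (q <= n)%N.
    rewrite leqNgt; apply/negP => nq; case: (posnP q) => [q0|q0].
      by rewrite q0 in nq.
    have := red q.-1; rewrite prednK// => /(_ erefl) /negP; apply.
    have := xt q.-1; rewrite xE /splice prednK// leqnn; apply.
    by rewrite -ltnS prednK.
  have Pq : P q.
    rewrite /P qn; apply/forallP => i; apply/implyP => qi.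
    by rewrite -xf// xE /splice ltnNge qi; exact: subP.
  have := pmin _ Pq; rewrite leq_eqVlt => /predU1P[pq|pq].
    apply: tt0; rewrite -(fin_seqK t) /t0 pq; apply: eq_fin_seq_of => i iq.
    by rewrite -xf ?(leq_trans iq)// xE /splice iq.
  have q0 : (0 < q)%N by exact: leq_ltn_trans pq.
  have := red q.-1; rewrite prednK// => /(_ erefl) /negP; apply.
  have qq : (q.-1 < q)%N by rewrite prednK.
  have -> : fin_seq t q.-1 = f q.-1.
    by rewrite -xf ?(leq_trans qq)// xE /splice qq.
  by apply: Pp; [rewrite -ltnS prednK|exact: leq_trans qn].
have [h hP ->] := code_measureE (hat_val S @^-1` (cylinder n f `&` tail_in S n)) redt0.
rewrite /= in hP *; have [[hf he] hS] := hP.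
transitivity (mu (sub_val S @^-1` cylinder n (splice p h f))).
  congr (mu _); apply/seteqP; split => y /=.
    move=> [yh [xf _]] i im; rewrite /splice; case: ifPn => [/yh//|pi].
    have spl : spliceable p (fin_seq t0) (sub_val S y).
      by apply: cylinder_spliceable yh => //; case: redt0.
    by rewrite -xf// graftE// /splice (negbTE pi).
  move=> yE; have yh : cylinder p h (sub_val S y).
    by move=> i ip; rewrite yE ?(leq_trans ip)// /splice ip.
  have spl : spliceable p (fin_seq t0) (sub_val S y).
    by apply: cylinder_spliceable yh => //; case: redt0.
  split => //; split=> i im; rewrite graftE// /splice.
    by case: ifPn => [/t0E//|pi]; rewrite yE// /splice (negbTE pi).
  by rewrite ltnNge (leq_trans pn im); exact: subP.
apply: (mu_inv _ gv); split; last first.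
  move=> i im; rewrite /splice; case: ifPn => [/hS//|pi].
  by apply: Pp => //; rewrite leqNgt.
split.
  move=> i im; rewrite /splice; case: (ltngtP i.+1 p) => [ip|pi|ip].
  - exact: hf.
  - exact: ff.
  - have := he; rewrite et0 -ip /= => ->; exact: fin_path_src ff im.
rewrite -fv; move: pn; rewrite leq_eqVlt => /predU1P[pE|pn].
  rewrite (@eq_endpoint _ h); last by move=> i im; rewrite /splice pE im.
  by move: he; rewrite et0 pE.
by apply: (eq_endpoint_gt pn) => i pi; rewrite /splice ltnNge pi.
Qed.

Let inf_path_eq (x y : inf_path B) : x = y :> edge_seq B -> x = y.
Proof.
by case: x y => x xP [y yP] /= xy; subst y; congr Path; exact: Prop_irrelevance.
Qed.

Let hat_measure_extends (A : set (borel (inf_path B))) : measurable A ->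
  hat_measure (hat_val S @^-1` (A `&` sub_paths S)) = mu (sub_val S @^-1` A).
Proof.
move=> mA; pose t0 := fin_seq_of 0 (point : inf_path B).
rewrite (@hat_measure_single t0); last first.
  move=> t tt0; apply: code_measure0 => -[_ _ red] y spl [_ xS].
  have tpos : (0 < tag t)%N.
    rewrite lt0n; apply/eqP => t0E; apply: tt0.
    by rewrite -(fin_seqK t) t0E; exact: eq_fin_seq_of.
  have := red (tag t).-1; rewrite prednK// => /(_ erefl)/negP; apply.
  by have := xS (tag t).-1; rewrite graftE// /splice prednK// leqnn.
have redt0 : reduced (tag t0) (fin_seq t0).
  by split => //=; rewrite subV0 inE.
have [h hP ->] := code_measureE (hat_val S @^-1` (A `&` sub_paths S)) redt0.
congr (mu _); apply/seteqP.
have graft0 y : hat_val S (graft (tag t0) (fin_seq t0) y) = sub_val S y.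
  by apply: inf_path_eq; rewrite graftE.
split => y /=; rewrite graft0; first by case=> _ [].
by move=> Ay; split => //; split => //; exact: subP.
Qed.

Let swap_step j n (v : vert B n) f g : fin_path_to v f -> fin_path_to v g ->
  hat_measure (hat_val S @^-1` (cylinder n f `&` tail_in S (n + j))) =
  hat_measure (hat_val S @^-1` (cylinder n g `&` tail_in S (n + j))).
Proof.
elim: j n v f g => [|j IH] n v f g fv gv.
  rewrite addn0; have [vS|vS] := boolP (v \in subV S n).
    have [h hv] := sub_fin_path_exists vS.
    by rewrite (hat_measure_cylinder vS fv hv) (hat_measure_cylinder vS gv hv).
  suff E u : fin_path_to v u ->
      hat_val S @^-1` (cylinder n u `&` tail_in S n) = set0 by rewrite !E.
  move=> [_ uv]; apply/seteqP; split => x //= [xu xt].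
  move: vS; rewrite -uv -(@eq_endpoint (hat_val S x) u n)// endpoint_src.
  by rewrite subV_src imset_f// xt.
have E u : fin_path_to v u ->
    hat_measure (hat_val S @^-1` (cylinder n u `&` tail_in S (n + j.+1))) =
    \sum_(e \in [set e | src e = v])
      hat_measure (hat_val S @^-1` (cylinder n.+1 (dfwith u n e) `&`
                                    tail_in S (n.+1 + j))).
  move=> [_ uv]; rewrite -measure_fin_bigcup//.
  - congr (hat_measure _); apply/seteqP; split => [x [xu xt]|x [e /= ev [xu xt]]].
      exists (hat_val S x n).
        by rewrite /= -endpoint_src -uv; exact: eq_endpoint.
      split => [i|]; last by rewrite addSnnS.
      rewrite ltnS leq_eqVlt => /predU1P[E|im].
        by subst n; rewrite dfwithin.
      by rewrite dfwithout ?xu//; apply/eqP; lia.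
    split; last by rewrite /= -addSnnS.
    move=> i im; rewrite (xu i (leqW im)) dfwithout//; apply/eqP; lia.
  - exact: finite_finset.
  - move=> e e' _ _ [x [[xe _] [xe' _]]].
    have := xe' n (ltnSn n); rewrite dfwithin => <-.
    by have := xe n (ltnSn n); rewrite dfwithin.
  - move=> e _; apply: measurable_hat; apply: measurableI.
      exact: measurable_cylinder.
    exact: measurable_tail_in.
rewrite !E//; apply: eq_fsbigr => e /set_mem /= ev.
have ext u : fin_path_to v u -> fin_path_to (rng e) (dfwith u n e).
  move=> [uf uv]; split; last by rewrite /= dfwithin.
  move=> i; rewrite ltnS leq_eqVlt => /predU1P[iE|im].
    subst n; rewrite dfwithin dfwithout; last by apply/eqP; lia.
    by rewrite ev -uv.
  by rewrite !dfwithout ?uf//; apply/eqP; lia.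
by apply: IH; exact: ext.
Qed.

Let hat_measure_invariant : hat_invariant hat_measure.
Proof.
move=> n v f g fv gv.
pose F u j := hat_val S @^-1` (cylinder n u `&` tail_in S (n + j)).
have mF u j : measurable (F u j : set (borel (hat_space S))).
  apply: measurable_hat; apply: measurableI; first exact: measurable_cylinder.
  exact: measurable_tail_in.
have UF u : hat_val S @^-1` cylinder n u = \bigcup_j F u j.
  apply/seteqP; split => [x xu|x [j _ []]//].
  have [y yS [N xy]] : hat_paths S (hat_val S x).
    by case: x xu => x xS _; exact: set_mem xS.
  exists N => //; split => // i Ni; rewrite xy//.
  exact: leq_trans (leq_addl _ _) Ni.
have cvgF u : hat_measure \o F u @ \oo --> hat_measure (\bigcup_j F u j).
  apply: nondecreasing_cvg_mu => //; first exact: bigcup_measurable.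
  move=> i j ij; apply/subsetPset => x [xu xt]; split => // k jk.
  by apply: xt; apply: leq_trans jk; rewrite leq_add2l.
rewrite !UF; have cf := cvgF f; have cg := cvgF g.
have fg : hat_measure \o F f = hat_measure \o F g.
  by apply/funext => j; exact: swap_step fv gv.
rewrite fg in cf; exact: (cvg_unique _ cf cg).
Qed.

Lemma hat_extension_exists :
  exists nu : {measure set (borel (hat_space S)) -> \bar R}, hat_extension mu nu.
Proof.
exists hat_measure; split.
- exact: hat_measure_extends.
- exact: hat_measure_invariant.
- exact: hat_measure_cylinder.
Qed.

End hat_extension_exists.

(* Main.v *)
Require Import Defs.
From HB Require Import structures.
From mathcomp Require Import all_boot all_order all_algebra.
From mathcomp Require Import all_classical all_reals all_analysis.
From mathcomp Require Import lra.

(** Suppose that [nu], the extension of [mu], had finite total mass [c].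
    Dividing by [c] and pushing forward to the whole path space would give a
    tail-invariant probability under which the paths of the subdiagram have mass
    [1 / c > 0].  Thinness only speaks of ergodic measures, so the point is to
    replace this invariant probability by an ergodic one without decreasing the
    mass of [sub_paths S] ([ergodic_exists]).

    This is the Bauer maximum principle.  The set [sub_paths S] is a decreasing
    intersection of clopen sets, so its mass is an upper semicontinuous affine
    function on the compact convex set of tail-invariant probabilities; it
    attains its maximum at an extreme point, and extreme points are ergodic.

    On the compact totally disconnected path space a probability is the same
    thing as a finitely additive set function on the clopen sets
    ([clopen_probability_extension]), because a disjoint countable union of clopen
    sets that is clopen has only finitely many nonempty terms.  The maximisation
    therefore takes place among finitely additive functions, where compactness
    is just the existence of pointwise limits along an ultrafilter
    ([tail_content_ulim]), and Caratheodory extension is applied once, to the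
    extreme point that was found.

    The extreme point is produced by successive maximisation
    ([extreme_maximizer]): among the maximisers of the mass of [sub_paths S],
    maximise the mass of a first clopen set, then of a second one, and so on
    through all of them, which are countably many.  Each step cuts out a nonempty
    compact face of the previous one, and two elements of the intersection of
    all the faces agree on every clopen set.

    Ergodicity of an extreme [P] ([extreme_ergodic]): if [A] is a saturated
    set with [0 < P A < 1], then [P] is a mixture of its conditionings on [A]
    and on the complement of [A].  Both are tail invariant
    ([invariant_cylinderI]): replacing the initial segment [g] of a path by
    another one with the same endpoint carries [P] on one cylinder to [P] on the
    other and preserves [A].  By extremality [P] conditioned on [A] is [P],
    whence [P A = 1]. *)

Set Implicit Arguments.
Unset Strict Implicit.
Unset Printing Implicit Defensive.
Import Order.TTheory GRing.Theory Num.Theory numFieldNormedType.Exports.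

Local Open Scope classical_set_scope.
Local Open Scope ring_scope.

(** * Ultralimits of bounded sequences *)

(** An ultrafilter finer than the filter of cofinite sets.  One fixed ultrafilter
    gives all bounded sequences a limit simultaneously, which replaces the
    extraction of subsequences. *)
Definition ultra : set_system nat :=
  sval (cid (ultraFilterLemma eventually_filter)).

Global Instance ultra_ultra : UltraFilter ultra.
Proof. by rewrite /ultra; case: cid => U []. Qed.

Lemma eventually_ultra : \oo `<=` ultra.
Proof. by rewrite /ultra; case: cid => U []. Qed.

Section ultralimit.
Variable R : realType.
Implicit Types (u w : nat -> R) (c : R).

Definition ulim u : R := lim (u @ ultra).

(** Along an ultrafilter a cluster point is a limit, so compactness of [0, 1] is
    enough. *)
Lemma ulim_cvg u : (forall k, 0 <= u k <= 1) -> u @ ultra --> ulim u.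
Proof.
move=> u01; apply/cvg_ex.
have [|p [_ up]] := @segment_compact R 0 1 (u @ ultra) _.
  by apply: (@filterE _ ultra) => k; rewrite /preimage /= in_itv /=; exact: u01.
exists p => V Vp.
have [//|nV] := in_ultra_setVsetC (u @^-1` V) ultra_ultra.
have [x [xnV xV]] := up (~` V) V nV Vp.
by case: (xnV xV).
Qed.

Lemma ulim_ge u c : (forall k, 0 <= u k <= 1) ->
  (forall e, 0 < e -> \forall k \near \oo, c - e <= u k) -> c <= ulim u.
Proof.
move=> u01 cu; apply/ler_addgt0Pr => e e0; rewrite -lerBlDr.
apply: limr_ge; first by apply/cvg_ex; exists (ulim u); exact: ulim_cvg.
exact/eventually_ultra/cu.
Qed.

End ultralimit.

(** * Extreme points of a compact convex set of functions *)

(** When the functions in [M] take values in [0, 1] at the indices in [Q] and [M] is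
    closed under ultralimits, every sequence in [M] has a cluster point in [M]
    for pointwise convergence on [Q]; compactness enters in this form.  Convexity
    enters only through the mixtures that happen to lie in [M].  The functions
    to be maximised are the [m |-> inf_n m (D k n)], for [k = 0, 1, ...]: they
    are upper semicontinuous and, the sequences being nonincreasing, affine. *)
Section extreme_points.
Variables (R : realType) (I : Type) (M : set (I -> R)) (Q : set I).
Hypothesis M01 : forall m i, M m -> Q i -> 0 <= m i <= 1.
Hypothesis M_ulim : forall u : nat -> I -> R,
  (forall k, M (u k)) -> M (fun i => ulim (u ^~ i)).
Variable D : nat -> nat -> I.
Hypothesis QD : forall k n, Q (D k n).
Hypothesis D_mono : forall m k, M m ->
  {homo (fun n => m (D k n)) : n n' / (n <= n')%N >-> n' <= n}.

Definition low k (m : I -> R) : R := inf [set m (D k n) | n in [set: nat]].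

Lemma low_le m k n : M m -> low k m <= m (D k n).
Proof.
move=> Mm; apply: ge_inf; last by exists n.
by exists 0 => _ [j _ <-]; have /andP[] := M01 Mm (QD k j).
Qed.

Lemma low_ge m k c : (forall n, c <= m (D k n)) -> c <= low k m.
Proof.
move=> cm; apply: lb_le_inf; first by exists (m (D k 0)), 0%N.
by move=> _ [n _ <-].
Qed.

Lemma low_lt m k c : low k m < c -> exists n, m (D k n) < c.
Proof.
move=> mc; apply: contrapT => H; move: mc; rewrite ltNge => /negP; apply.
by apply: low_ge => n; rewrite leNgt; apply/negP => h; apply: H; exists n.
Qed.

Definition mixture t (q r m : I -> R) :=
  forall i, Q i -> m i = t * q i + (1 - t) * r i.

(** Monotonicity lets one index come close to both infima at once. *)
Lemma low_mixture t q r m k : M m -> M q -> M r -> 0 < t < 1 ->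
  mixture t q r m ->
  low k m <= t * low k q + (1 - t) * low k r.
Proof.
move=> Mm Mq Mr /andP[t0 t1] mE; apply/ler_addgt0Pr => e e0.
have [a qa] : exists n, q (D k n) < low k q + e by apply: low_lt; rewrite ltrDl.
have [b rb] : exists n, r (D k n) < low k r + e by apply: low_lt; rewrite ltrDl.
apply: le_trans (low_le k (maxn a b) Mm) _; rewrite mE//.
have := D_mono k Mq (leq_maxl a b); have := D_mono k Mr (leq_maxr a b) => /=.
nra.
Qed.

(** Lexicographic maximisation: the faces decrease to a set whose members are
    told apart by none of the functions [low k]. *)
Fixpoint face k : set (I -> R) :=
  if k is j.+1 then
    [set m | face j m /\ forall m', face j m' -> low j m' <= low j m]
  else M.

Lemma face_sub k : face k.+1 `<=` face k.
Proof. by move=> m []. Qed.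

Lemma face_le j k : (j <= k)%N -> face k `<=` face j.
Proof.
elim: k => [|k IH]; first by rewrite leqn0 => /eqP->.
rewrite leq_eqVlt => /predU1P[->//|jk].
exact: subset_trans (@face_sub k) (IH jk).
Qed.

Lemma face_M k : face k `<=` M.
Proof. exact: (@face_le 0). Qed.

(** The maximum of [low k] is a lower bound along a sequence of maximisers, and
    lower bounds on [low k] pass to ultralimits (upper semicontinuity). *)
Lemma face_ulim k (u : nat -> I -> R) : (forall j, M (u j)) ->
  (\forall j \near \oo, face k (u j)) -> face k (fun i => ulim (u ^~ i)).
Proof.
move=> Mu; elim: k => [|k IH] uk; first exact: M_ulim.
split; first by apply: IH; apply: filterS uk => j [].
move=> m' km'; apply: low_ge => n; apply: ulim_ge => [j|e e0]; first exact: M01.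
apply: filterS uk => j [_ /(_ _ km') h].
by have := low_le k n (Mu j); lra.
Qed.

(** The ultralimit of a maximising sequence is a maximiser. *)
Lemma face_nonempty k : M !=set0 -> face k !=set0.
Proof.
move=> M0; elim: k => [//|k [m km]].
pose L := [set low k m | m in face k].
have supL : has_sup L.
  split; first by exists (low k m), m.
  exists 1 => _ [m' /face_M Mm' <-]; apply: le_trans (low_le k 0 Mm') _.
  by have /andP[] := M01 Mm' (QD k 0).
have app (j : nat) : {m | face k m /\ sup L - j.+1%:R^-1 < low k m}.
  apply: cid; have j0 : 0 < (j.+1%:R^-1 : R) by rewrite invr_gt0 ltr0n.
  by have [_ [m' km' <-] h] := sup_adherent j0 supL; exists m'.
pose u j := sval (app j).
have uP j : face k (u j) /\ sup L - j.+1%:R^-1 < low k (u j) := svalP (app j).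
have Mu j : M (u j) by apply: face_M (uP j).1.
exists (fun i => ulim (u ^~ i)); split.
  by apply: face_ulim => //; apply: filterE => j; exact: (uP j).1.
move=> m' km'; apply: (@le_trans _ _ (sup L)).
  by apply: ub_le_sup; [exact: supL.2|exists m'].
apply: low_ge => n; apply: ulim_ge => [j|e e0]; first exact: M01.
near=> j; apply: le_trans (low_le k n (Mu j)).
apply: le_trans (ltW (uP j).2); rewrite lerD2l lerN2 ltW//.
by near: j; exact: near_infty_natSinv_lt (PosNum e0).
Unshelve. all: by end_near. Qed.

(** If neither component of a mixture exceeds the maximum that the mixture
    attains, both attain it. *)
Lemma face_mixture k t q r m : face k m -> M q -> M r -> 0 < t < 1 ->
  mixture t q r m -> face k q /\ face k r.
Proof.
move=> + Mq Mr t01 mE; elim: k => [//|k IH] [km maxm].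
have [kq kr] := IH km.
have := low_mixture k (face_M km) Mq Mr t01 mE.
have := maxm _ kq; have := maxm _ kr; move: t01 => /andP[t0 t1] hr hq hm.
have Eq : low k q = low k m by apply/eqP; rewrite eq_le hq /=; nra.
have Er : low k r = low k m by apply/eqP; rewrite eq_le hr /=; nra.
by split; split=> //; rewrite ?Eq ?Er.
Qed.

(** A point [m] of all the faces is obtained as the ultralimit of a sequence whose
    [k]-th term lies in [face k].  The last clause is extremality of [m], as far
    as the functions [low k] can tell points of [M] apart. *)
Lemma extreme_maximizer m0 : M m0 -> exists m, [/\ M m, low 0 m0 <= low 0 m &
  forall t q r, M q -> M r -> 0 < t < 1 -> mixture t q r m ->
    forall k, low k q = low k m].
Proof.
move=> Mm0; have M0 : M !=set0 by exists m0.
pose u k := sval (cid (face_nonempty k M0)).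
have uP k : face k (u k) := svalP (cid (face_nonempty k M0)).
have Mu k : M (u k) := face_M (uP k).
pose m i := ulim (u ^~ i).
have mP k : face k m.
  by apply: face_ulim => //; exists k => // j /= kj; exact: (face_le kj (uP j)).
exists m; split; [exact: (mP 0)|exact: (mP 1).2|].
move=> t q r Mq Mr t01 mE k.
have [[kq maxq] _] := face_mixture (mP k.+1) Mq Mr t01 mE.
have [km maxm] := mP k.+1; apply/eqP; rewrite eq_le; apply/andP; split.
  exact: maxm.
exact: maxq.
Qed.

End extreme_points.

(** * Image measures and measures of total mass one *)

Lemma image_measure_exists d d' (T : measurableType d) (T' : measurableType d')
    (R : realType) (m : {measure set T -> \bar R}) (f : T -> T') :
  measurable_fun [set: T] f ->
  exists m' : {measure set T' -> \bar R}, forall A, m' A = m (f @^-1` A).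
Proof.
by move=> mf; unshelve eexists [the measure _ _ of pushforward m f].
Qed.

(** [unit_measure] carries the proof of total mass one as a parameter so that the
    probability structure can be inferred. *)
Section unit_measure.
Context d (T : measurableType d) (R : realType) (mu : {measure set T -> \bar R}).

Definition unit_measure of mu setT = 1%E : set T -> \bar R := mu.

Hypothesis muT : mu setT = 1%E.

HB.instance Definition _ := Measure.on (unit_measure muT).
HB.instance Definition _ :=
  Measure_isProbability.Build _ _ _ (unit_measure muT) muT.

End unit_measure.

(** * Finitely additive probabilities on clopen sets *)

Record clopen_probability (R : realType) (T : topologicalType) (m : set T -> R) :
    Prop := {
  clopen_prob_ge0 : forall A, clopen A -> 0 <= m A;
  clopen_probT : m setT = 1;
  clopen_probU : forall A C, clopen A -> clopen C -> A `&` C = set0 ->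
    m (A `|` C) = m A + m C }.

Section clopen_probability_theory.
Variables (R : realType) (T : topologicalType) (m : set T -> R).
Hypothesis mP : clopen_probability m.

Lemma clopen_prob0 : m set0 = 0.
Proof.
have := clopen_probU mP clopen0 clopen0 (setI0 _); rewrite setU0; lra.
Qed.

Lemma clopen_prob_le A C : clopen A -> clopen C -> A `<=` C -> m A <= m C.
Proof.
move=> cA cC AsubC; rewrite -(setDUK AsubC).
have cD : clopen (C `\` A) by exact: clopenI cC (clopenC set0 cA).
rewrite (clopen_probU mP)//; last by rewrite setDE setICA setICr setI0.
by rewrite lerDl (clopen_prob_ge0 mP).
Qed.

Lemma clopen_prob_itv01 A : clopen A -> 0 <= m A <= 1.
Proof.
move=> cA; rewrite (clopen_prob_ge0 mP)//= -(clopen_probT mP).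
by apply: clopen_prob_le => //; exact: clopenT.
Qed.

Lemma clopen_prob_bigcup (F : nat -> set T) n : (forall k, clopen (F k)) ->
  trivIset setT F ->
  clopen (\big[setU/set0]_(i < n) F i) /\
  m (\big[setU/set0]_(i < n) F i) = \sum_(i < n) m (F i).
Proof.
move=> cF tF; elim: n => [|n [cU IH]].
  by rewrite !big_ord0 clopen_prob0; split => //; exact: clopen0.
rewrite !big_ord_recr /=; split; first exact: clopenU.
rewrite (clopen_probU mP)// ?IH//.
by apply: (@trivIset_bigsetUI _ xpredT); first exact: sub_trivIset tF.
Qed.

End clopen_probability_theory.

Definition clopen_display : Type -> measure_display. Proof. exact. Qed.

(** A copy of [T] whose measurable sets are the clopen sets; it is the domain of
    the measure to which the extension theorem is applied. *)
Definition clopen_algebra (T : ptopologicalType) : Type := T.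

Section clopen_algebra.
Variable T : ptopologicalType.

Let clopen_setC : setC_closed (@clopen T).
Proof. by move=> A; exact: clopenC set0. Qed.

HB.instance Definition _ := Pointed.on (clopen_algebra T).
HB.instance Definition _ := isAlgebraOfSets.Build (clopen_display T)
  (clopen_algebra T) clopen0 clopenU clopen_setC.

End clopen_algebra.

(** On a compact space whose Borel sets are generated by the clopen sets,
    finitely additive probabilities on clopen sets extend to Borel
    probabilities. *)
Section clopen_probability_extension.
Variables (R : realType) (T : ptopologicalType).
Hypothesis compactT : compact [set: T].
Hypothesis open_clopen : @open T `<=` <<s @clopen T >>.
Variable m : set T -> R.
Hypothesis mP : clopen_probability m.

(* The absolute value only serves to make [mu] nonnegative on sets that are not
   clopen, where nothing is known of [m]. *)
Let mu (A : set (clopen_algebra T)) : \bar R := `|m A|%:E.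

Let mu0 : mu set0 = 0%E.
Proof. by rewrite /mu (clopen_prob0 mP) normr0. Qed.

Let mu_ge0 A : (0 <= mu A)%E.
Proof. by rewrite lee_fin. Qed.

Let muE A : clopen A -> mu A = (m A)%:E.
Proof. by move=> cA; rewrite /mu ger0_norm// (clopen_prob_ge0 mP). Qed.

(* A clopen set is compact, so if it is a disjoint union of clopen sets then all
   but finitely many of these are empty. *)
Let mu_sigma_additive : semi_sigma_additive mu.
Proof.
move=> F cF tF cUF; apply: cvg_near_cst.
have clF k : closed (F k) by have [] := cF k.
have [D _ cover_D] : finite_subset_cover setT F (\bigcup_k F k).
  have: compact (\bigcup_k F k : set T).
    by apply: subclosed_compact compactT _ => //; have [] := cUF.
  rewrite compact_cover; apply => //.
  by move=> k _; have [] := cF k.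
pose N := (\max_(i <- finmap.enum_fset D) i).+1.
have F_out k : (N <= k)%N -> F k = set0.
  move=> Nk; apply/seteqP; split => // x Fkx.
  have [j /= jD Fjx] := cover_D x (ex_intro2 _ _ k I Fkx).
  have jN : (j < N)%N by rewrite ltnS; apply: leq_bigmax_seq.
  have jk : j = k by apply: tF => //; exists x.
  by move: jN; rewrite jk ltnNge Nk.
exists N => // n /= Nn.
have [_ mU] := clopen_prob_bigcup mP n cF tF.
rewrite big_mkord muE//.
have -> : \bigcup_k F k = \big[setU/set0]_(i < n) F i.
  rewrite -bigcup_mkord; apply/seteqP; split => x [k _ Fkx]; last by exists k.
  exists k => //=; rewrite ltnNge; apply/negP => /(leq_trans Nn) /F_out Fk0.
  by rewrite Fk0 in Fkx.
rewrite mU sumEFin; congr EFin; apply: eq_bigr => i _.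
exact/ger0_norm/(clopen_prob_ge0 mP (cF i)).
Qed.

HB.instance Definition _ := isMeasure.Build _ _ _ mu mu0 mu_ge0 mu_sigma_additive.

Let ext : {measure set (g_sigma_algebraType (@clopen T)) -> \bar R} :=
  [the measure _ _ of measure_extension [the measure _ _ of mu]].

Let measurable_id : measurable_fun [set: g_sigma_algebraType (@clopen T)]
  (id : _ -> borel T).
Proof.
apply: (@measurability _ _ (g_sigma_algebraType (@clopen T)) (borel T) _ id
  (@open T)) => //.
by move=> _ [A oA <-]; rewrite setTI; exact: open_clopen.
Qed.

Lemma clopen_probability_extension :
  exists P : probability (borel T) R, forall A, clopen A -> P A = (m A)%:E.
Proof.
have [nu nuE] := image_measure_exists ext measurable_id.
have nu_m A : clopen A -> nu A = (m A)%:E.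
  move=> cA; rewrite nuE preimage_id /ext /= /measure_extension.
  by rewrite measurable_mu_extE//= muE.
have nuT : nu setT = 1%E by rewrite nu_m ?(clopen_probT mP)//; exact: clopenT.
by exists [the probability _ _ of unit_measure nuT].
Qed.

End clopen_probability_extension.

(** * Cylinders and the topology of the path space *)

Lemma countable_enum (T : Type) (A : set T) (a : T) : countable A -> A a ->
  exists e : nat -> T, range e = A.
Proof.
move=> /pfcard_geP[->//|[e]] _; exists e; exact: image_eq.
Qed.

Section paths.
Variable B : bratteli.
Implicit Types (x y z : inf_path B) (f g : edge_seq B).

Lemma cylinder_sub n m f : (m <= n)%N -> cylinder n f `<=` cylinder m f.
Proof. by move=> mn x xf i im; apply: xf; exact: leq_trans mn. Qed.

Lemma clopen_prefix n (A : set (inf_path B)) :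
  (forall x y, cylinder n x y -> A x -> A y) -> clopen A.
Proof.
move=> Adec; split; first by move=> x Ax; exists n => y xy; exact: Adec Ax.
rewrite -openC; have : path_open (~` A) => [x nAx|//].
exists n => y xy Ay; apply: nAx.
by apply: Adec Ay => i im; rewrite xy.
Qed.

Lemma clopen_cylinder n f : clopen (cylinder n f).
Proof. by apply: (@clopen_prefix n) => x y xy xf i im; rewrite xy// xf. Qed.

Lemma cylinderI n f k g y : cylinder n f y -> cylinder k g y ->
  cylinder n f `&` cylinder k g = cylinder (maxn n k) y.
Proof.
move=> fy gy; apply/seteqP; split => [x [fx gx] i|x xy].
  by rewrite leq_max => /orP[im|im]; [rewrite fx// fy|rewrite gx// gy].
split => i im; first by rewrite xy ?leq_max ?im// fy.
by rewrite xy ?leq_max ?im ?orbT// gy.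
Qed.

(** The empty set is included to make this a pi-system, which is what uniqueness
    of measures asks of a generating family. *)
Definition cylinders : set (set (inf_path B)) :=
  [set A | A = set0 \/ exists n x, A = cylinder n x].

Lemma cylinders_setI : setI_closed cylinders.
Proof.
move=> A C [->|[n [x ->]]] [->|[k [y ->]]]; rewrite ?set0I ?setI0; try by left.
have [[z [xz yz]]|H] := pselect (cylinder n x `&` cylinder k y !=set0).
  by right; exists (maxn n k), z; exact: cylinderI.
by left; apply/eqP/negPn/negP => /set0P.
Qed.

(** A nonempty cylinder is given by finitely many edges, hence by an element of a
    countable type. *)
Lemma countable_cylinders : countable cylinders.
Proof.
pose code := {n : nat & {dffun forall i : 'I_n, edge B i}}.
pose F (o : option code) : set (inf_path B) :=
  if o is Some t then [set x | forall i, x (val i) = tagged t i] else set0.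
apply: (@card_le_trans _ _ _ (F @` setT)); last first.
  exact: card_le_trans (card_image_le _ _) (countableP _).
apply: subset_card_le => _ [->|[n [x ->]]]; first by exists None.
exists (Some (Tagged (fun n => {dffun forall i : 'I_n, edge B i})
                     [ffun i : 'I_n => x i])) => //.
apply/seteqP; split => y /= xy; last by move=> i; rewrite ffunE; exact: xy.
by move=> i im; have := xy (Ordinal im); rewrite ffunE.
Qed.

Lemma cylinders_clopen : cylinders `<=` clopen.
Proof.
by move=> _ [->|[n [x ->]]]; [exact: clopen0|exact: clopen_cylinder].
Qed.

Lemma second_countable_path : @second_countable (inf_path B).
Proof.
exists cylinders; first exact: countable_cylinders.
split=> [A /cylinders_clopen[]//|x U].
rewrite nbhsE => -[V [oV Vx] VU]; have [n nV] := oV x Vx.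
exists (cylinder n x); last exact: subset_trans VU.
by split; [right; exists n, x|].
Qed.

Lemma open_cylinders : @open (inf_path B) `<=` <<s cylinders >>.
Proof.
have [e eE] : exists e : nat -> set (inf_path B), range e = cylinders.
  by apply: (@countable_enum _ _ set0); [exact: countable_cylinders|left].
move=> A oA.
have -> : A = \bigcup_(k in [set k | e k `<=` A]) e k.
  apply/seteqP; split => [x Ax|x [k kA] /kA//].
  have [n nA] := oA x Ax.
  have [k _ ek] : range e (cylinder n x) by rewrite eE; right; exists n, x.
  by exists k; rewrite /= ek.
apply: (@bigcup_measurable _ (g_sigma_algebraType cylinders)) => k _.
by apply: sub_sigma_algebra; rewrite -eE; exists k.
Qed.

Lemma borel_cylinders : @measurable _ (borel (inf_path B)) = <<s cylinders >>.
Proof.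
apply/seteqP; split; apply: smallest_sub.
- exact: smallest_sigma_algebra.
- exact: open_cylinders.
- exact: smallest_sigma_algebra.
- by move=> A /cylinders_clopen[oA _]; exact: sub_sigma_algebra.
Qed.

End paths.

(** * Tail-invariant probabilities *)

Section grafting.
Variable B : bratteli.
Implicit Types (x y z : inf_path B) (f g : edge_seq B).

Lemma endpoint_src x n : endpoint x n = src (x n).
Proof. by case: n => [|n] /=; [rewrite [RHS]vrootP|rewrite path_chain]. Qed.

Lemma eq_endpoint f g n : (forall i, (i < n)%N -> f i = g i) ->
  endpoint f n = endpoint g n.
Proof. by case: n => //= n -> //. Qed.

Lemma fin_path_to_path x n : fin_path_to (endpoint x n) x.
Proof. by split=> // i _; exact: path_chain. Qed.

Definition graft_edges n f g : edge_seq B :=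
  fun i => if (i < n)%N then f i else g i.

Lemma graft_chain n f x : fin_path_to (endpoint x n) f ->
  forall i, rng (graft_edges n f x i) = src (graft_edges n f x i.+1).
Proof.
move=> [ff fx] i; rewrite /graft_edges; case: (ltngtP i.+1 n) => [im|ni|ni].
- exact: ff.
- exact: path_chain.
- by move: fx; rewrite -ni endpoint_src.
Qed.

(** When replacing the first [n] edges of [x] by those of [f] does not give a path,
    the value [x] keeps the map total, tail-preserving and continuous. *)
Definition graft n f x : inf_path B :=
  if pselect (fin_path_to (endpoint x n) f) is left H then Path (graft_chain H)
  else x.

Lemma graft_lt n f x i : fin_path_to (endpoint x n) f -> (i < n)%N ->
  graft n f x i = f i.
Proof.
by move=> fx im; rewrite /graft; case: pselect => //= H; rewrite /graft_edges im.
Qed.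

Lemma graft_ge n f x i : (n <= i)%N -> graft n f x i = x i.
Proof.
move=> ni; rewrite /graft; case: pselect => //= H.
by rewrite /graft_edges ltnNge ni.
Qed.

Lemma graft_tail n f x : tail_equiv (graft n f x) x.
Proof. by exists n => i ni; exact: graft_ge. Qed.

Lemma graft_cylinder n k f x y : (n <= k)%N -> cylinder k x y ->
  cylinder k (graft n f x) (graft n f y).
Proof.
move=> nk xy i ik; have e : endpoint y n = endpoint x n.
  by apply: eq_endpoint => j jn; apply: xy; exact: leq_trans nk.
have [ni|im] := leqP n i; first by rewrite !graft_ge// xy.
have [H|H] := pselect (fin_path_to (endpoint x n) f).
  by rewrite !graft_lt// e.
rewrite /graft; case: pselect => [H'|_]; first by case: H; rewrite -e.
by case: pselect => // _; exact: xy.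
Qed.

Lemma measurable_graft n f :
  measurable_fun [set: borel (inf_path B)] (graft n f : _ -> borel (inf_path B)).
Proof.
apply: (@measurability _ _ (borel (inf_path B)) (borel (inf_path B)) _
  (graft n f) (@open (inf_path B))) => //.
move=> _ [U oU <-]; rewrite setTI; apply: sub_sigma_algebra.
have : path_open (graft n f @^-1` U) => [x /oU[k kU]|//].
exists (maxn n k) => y xy; apply: kU.
exact: (cylinder_sub (leq_maxr n k)) (graft_cylinder f (leq_maxl n k) xy).
Qed.

(** Grafting [f] on the paths that begin with [g] matches the cylinders inside
    [cylinder n f] with cylinders inside [cylinder n g] that end at the same
    vertex; this is why it preserves tail-invariant measures. *)
Lemma graft_preimage_cylinder n (v : vert B n) f g k x y :
  fin_path_to v f -> fin_path_to v g ->
  cylinder k x y -> cylinder n f y ->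
  graft n f @^-1` cylinder k x `&` cylinder n g =
  cylinder (maxn n k) (graft n g y).
Proof.
move=> fv gv xy fy.
have ey : endpoint y n = v by rewrite (eq_endpoint fy); exact: fv.2.
have ew w : cylinder n g w -> endpoint w n = v.
  by move=> gw; rewrite (eq_endpoint gw); exact: gv.2.
have gy : fin_path_to (endpoint y n) g by rewrite ey.
apply/seteqP; split => w /=.
  move=> [xw gw] i; have [ni|im] := leqP n i.
    rewrite leq_max ltnNge ni /= => ik.
    by rewrite graft_ge// -(graft_ge f w ni) xw// xy.
  by rewrite gw// graft_lt.
move=> yw; have gw : cylinder n g w.
  by move=> i im; rewrite yw ?leq_max ?im// graft_lt.
split => // i ik; have [ni|im] := leqP n i.
  by rewrite graft_ge// yw ?leq_max ?ik ?orbT// graft_ge// xy.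
by rewrite graft_lt ?ew// -xy// fy.
Qed.

End grafting.

Section tail_invariance.
Variables (R : realType) (B : bratteli).
Variable P : probability (borel (inf_path B)) R.
Hypothesis P_inv : tail_invariant P.

Lemma measurable_clopen (A : set (inf_path B)) : clopen A ->
  measurable (A : set (borel (inf_path B))).
Proof. by move=> [oA _]; exact: sub_sigma_algebra. Qed.

Lemma measurable_cylinder n (f : edge_seq B) :
  measurable (cylinder n f : set (borel (inf_path B))).
Proof. by apply: measurable_clopen; exact: clopen_cylinder. Qed.

(** Invariance, which is postulated on cylinders, persists on their traces on a
    saturated set [A]: grafting [f] carries [P] on [cylinder n g] to [P] on
    [cylinder n f], by uniqueness of measures, and maps each path to a tail
    equivalent one. *)
Lemma invariant_cylinderI (A : set (borel (inf_path B))) n (v : vert B n) f g :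
  measurable A -> (forall x y, tail_equiv x y -> A x -> A y) ->
  fin_path_to v f -> fin_path_to v g ->
  P (A `&` cylinder n f) = P (A `&` cylinder n g).
Proof.
move=> mA A_inv fv gv.
have mf := measurable_cylinder n f; have mg := measurable_cylinder n g.
have [nu nuE] := image_measure_exists (mrestr P mg) (measurable_graft n f).
have -> : P (A `&` cylinder n g) = nu A.
  rewrite nuE /= /mrestr; congr (P _).
  apply/seteqP; split => x [Ax gx]; split => //.
    apply: A_inv Ax; have [N h] := graft_tail n f x.
    by exists N => i Ni; rewrite h.
  by apply: A_inv Ax; exact: graft_tail.
rewrite -[LHS]/(mrestr P mf A).
apply: (@measure_unique _ R (borel (inf_path B)) (@cylinders B) (fun=> setT)
  (@borel_cylinders B) (@cylinders_setI B) _ _ [the measure _ _ of mrestr P mf] nu)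
  => //.
- by move=> _; right; exists 0, point; apply/seteqP; split.
- by rewrite bigcup_const.
- move=> C [->|[k [x ->]]]; first by rewrite !measure0.
  rewrite nuE /= /mrestr.
  have [[y [xy fy]]|H] := pselect (cylinder k x `&` cylinder n f !=set0).
    rewrite (graft_preimage_cylinder fv gv xy fy) setIC (cylinderI fy xy).
    set N := maxn n k.
    apply: (P_inv (fin_path_to_path y N)).
    have -> : endpoint y N = endpoint (graft n g y) N.
      by rewrite !endpoint_src graft_ge// leq_maxl.
    exact: fin_path_to_path.
  rewrite (_ : _ `&` _ = set0); last by apply/eqP/negPn/negP => /set0P.
  rewrite [in RHS](_ : _ `&` _ = set0)//; apply/seteqP; split => w //= [xw gw].
  apply: H; exists (graft n f w); split=> // i im; rewrite graft_lt//.
  by rewrite (eq_endpoint gw) gv.2.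
- move=> _; apply: le_lt_trans (probability_le1 _ _) (ltry _).
  by apply: measurableI.
Qed.

End tail_invariance.

(** * Existence of ergodic measures *)

Section existence_of_ergodic_measures.
Variables (R : realType) (B : bratteli).
Implicit Types (m q r : set (inf_path B) -> R).
Implicit Types (P : probability (borel (inf_path B)) R).

(** When the path space is compact these are, on clopen sets, the traces of the
    tail-invariant probabilities; the values at other sets are arbitrary. *)
Definition tail_content m : Prop := clopen_probability m /\
  forall n (v : vert B n) f g, fin_path_to v f -> fin_path_to v g ->
    m (cylinder n f) = m (cylinder n g).

Lemma tail_content01 m A : tail_content m -> clopen A -> 0 <= m A <= 1.
Proof. by move=> [mP _]; exact: clopen_prob_itv01. Qed.

Lemma tail_content_ulim (u : nat -> set (inf_path B) -> R) :
  (forall k, tail_content (u k)) -> tail_content (fun A => ulim (u ^~ A)).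
Proof.
move=> uM; have u01 A : clopen A -> forall k, 0 <= u k A <= 1.
  by move=> cA k; exact: tail_content01.
split; first split.
- move=> A cA; apply: ulim_ge => [|e e0]; first exact: u01.
  by apply: nearW => k; have /andP[uk _] := u01 A cA k; lra.
- rewrite (_ : u ^~ setT = cst 1); first exact: lim_cst.
  by apply/funext => k; exact: clopen_probT (uM k).1.
- move=> A C cA cC AC0.
  rewrite (_ : u ^~ (A `|` C) = u ^~ A \+ u ^~ C).
    by apply: cvg_lim => //; apply: cvgD; apply: ulim_cvg; exact: u01.
  by apply/funext => k; exact: clopen_probU (uM k).1 _ _ cA cC AC0.
- move=> n v f g fv gv; rewrite (_ : u ^~ _ = u ^~ (cylinder n g))//.
  by apply/funext => k; exact: (uM k).2 fv gv.
Qed.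

Lemma conditional_tail_content P (A : set (borel (inf_path B))) (a : R) :
  tail_invariant P -> measurable A ->
  (forall x y, tail_equiv x y -> A x -> A y) -> P A = a%:E -> 0 < a ->
  tail_content (fun C => fine (P (A `&` C)) / a).
Proof.
move=> P_inv mA A_inv PA a0; split; first split.
- by move=> C cC; rewrite divr_ge0 ?fine_ge0// ltW.
- by rewrite setIT PA /= divff// gt_eqF.
- move=> C D cC cD CD0; have mC := measurable_clopen cC.
  have mD := measurable_clopen cD.
  rewrite setIUr measureU; [|exact: measurableI|exact: measurableI|].
    by rewrite fineD ?mulrDl//; exact: fin_num_measure (measurableI _ _ _ _).
  by rewrite setIACA CD0 setI0.
- move=> n v f g fv gv.
  by rewrite (invariant_cylinderI P_inv mA A_inv fv gv).
Qed.

(** If [P] were not ergodic, conditioning on a saturated set and on its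
    complement would write it as a proper mixture.  Extremality turns this into
    [P (C `&` A) = P A * P C] for clopen [C], hence for Borel [C], and [C = A]
    gives [P A = P A ^+ 2]. *)
Lemma extreme_ergodic m P : (forall C, clopen C -> P C = (m C)%:E) ->
  tail_invariant P ->
  (forall t q r, tail_content q -> tail_content r -> 0 < t < 1 ->
    mixture (@clopen _) t q r m -> forall C, clopen C -> q C = m C) ->
  ergodic P.
Proof.
move=> PE P_inv m_ext A mA A_inv.
pose a := fine (P A).
have PA : P A = a%:E by rewrite fineK// fin_num_measure.
have a01 : 0 <= a <= 1 by rewrite -!lee_fin -PA probability_le1// measure_ge0.
have [a0|a0] := eqVneq a 0; first by left; apply: etrans PA _; rewrite a0.
have [a1|a1] := eqVneq a 1; first by right; apply: etrans PA _; rewrite a1.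
have a01' : 0 < a < 1 by rewrite lt0r lt_neqAle a0 a1.
have /andP[a_gt0 a_lt1] := a01'.
have mA' : measurable (~` A) by exact: measurableC.
have A'_inv x y : tail_equiv x y -> (~` A) x -> (~` A) y.
  move=> [N xy] nAx Ay; apply: nAx; apply: A_inv Ay.
  by exists N => i Ni; rewrite xy.
have PA' : P (~` A) = (1 - a)%:E by rewrite probability_setC// PA.
have a'_gt0 : 0 < 1 - a by rewrite subr_gt0.
have mix : mixture (@clopen _) a (fun C => fine (P (A `&` C)) / a)
    (fun C => fine (P (~` A `&` C)) / (1 - a)) m.
  move=> C cC; have mC := measurable_clopen cC.
  rewrite !(mulrC _ (_ / _)) !divfK ?gt_eqF//.
  apply: EFin_inj; rewrite EFinD !fineK ?fin_num_measure//; try exact: measurableI.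
  by rewrite -PE// (measureDI P mC mA) [LHS]addeC setDE !(setIC C).
have qm := m_ext _ _ _ (conditional_tail_content P_inv mA A_inv PA a_gt0)
  (conditional_tail_content P_inv mA' A'_inv PA' a'_gt0) a01' mix.
have PAC C : clopen C -> P (C `&` A) = (a%:E * P C)%E.
  move=> cC; have mC := measurable_clopen cC.
  rewrite (PE C)// -qm// -EFinM mulrC divfK// setIC fineK// fin_num_measure//.
  exact: measurableI.
have a_ge0 := ltW a_gt0.
have : P (A `&` A) = (a%:E * P A)%E.
  apply: (@measure_unique _ R (borel (inf_path B)) (@cylinders B) (fun=> setT)
    (@borel_cylinders B) (@cylinders_setI B) _ _ [the measure _ _ of mrestr P mA]
    [the measure _ _ of mscale (NngNum a_ge0) P]) => //.
  - by move=> _; right; exists 0%N, point; apply/seteqP; split.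
  - by rewrite bigcup_const.
  - by move=> C /cylinders_clopen; exact: PAC.
  - move=> _; apply: le_lt_trans (probability_le1 _ _) (ltry _).
    by apply: measurableI.
rewrite setIid PA -EFinM => aa; case/negP: a1; apply/eqP/(mulfI a0).
by rewrite -(EFin_inj aa) mulr1.
Qed.

(** The mass of a decreasing intersection of clopen sets is maximised first, and
    then that of every clopen set in turn, in order to reach an extreme point. *)
Lemma ergodic_exists m0 (K : nat -> set (inf_path B)) (c : R) :
  compact [set: inf_path B] -> tail_content m0 ->
  (forall n, clopen (K n)) -> nonincreasing_seq K -> (forall n, c <= m0 (K n)) ->
  exists P, [/\ tail_invariant P, ergodic P & (c%:E <= P (\bigcap_n K n))%E].
Proof.
move=> compactX m0M cK K_dec m0K.
have [e eE] : exists e : nat -> set (inf_path B), range e = @clopen _.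
  apply: (@countable_enum _ _ set0); last exact: clopen0.
  exact: clopen_countable compactX (@second_countable_path B).
have ce k : clopen (e k) by rewrite -eE; exists k.
pose D k n := if k is j.+1 then e j else K n.
have cD k n : clopen (D k n) by case: k => /=.
have [|m [mM m_max m_ext]] := @extreme_maximizer R (set (inf_path B)) tail_content
    (@clopen _) tail_content01
    tail_content_ulim D cD _ m0 m0M.
  move=> m [|k] mM n n' nn'//=; apply: (clopen_prob_le mM.1) => //.
  exact/subsetPset/K_dec.
have mK n : c <= m (K n).
  apply: le_trans (low_le tail_content01 cD 0 n mM).
  by apply: le_trans m_max; exact: low_ge.
have open_sigma : @open (inf_path B) `<=` <<s @clopen (inf_path B) >>.
  apply: (subset_trans (@open_cylinders B)); apply: smallest_sub.
    exact: smallest_sigma_algebra.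
  by move=> A /cylinders_clopen cA; exact: sub_sigma_algebra.
have [P PE] := clopen_probability_extension compactX open_sigma mM.1.
have P_inv : tail_invariant P.
  move=> n v f g fv gv; have PcE h := PE _ (clopen_cylinder n h).
  by apply: etrans (PcE f) (etrans _ (esym (PcE g))); rewrite (mM.2 n v f g).
exists P; split => //.
  apply: (extreme_ergodic PE P_inv) => t q r qM rM t01 mix C.
  rewrite -eE => -[k _ <-].
  have := m_ext t q r qM rM t01 mix k.+1.
  have low_cst m' : low D k.+1 m' = m' (e k).
    rewrite /low /= (_ : [set _ | _ in _] = [set m' (e k)]) ?inf1//.
    by apply/seteqP; split => [_ [n _ <-]|_ ->]//; exists 0%N.
  by rewrite !low_cst.
have mKn n := measurable_clopen (cK n).
have PK : P \o K @ \oo --> P (\bigcap_n K n).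
  apply: nonincreasing_cvg_mu => //; last exact: bigcap_measurable.
  by rewrite /= PE// ltry.
rewrite -(cvg_lim _ PK)//; apply: lime_ge.
  by apply/cvg_ex; eexists; exact: PK.
by apply: nearW => n /=; rewrite PE// lee_fin.
Qed.

End existence_of_ergodic_measures.

(** * Thin subdiagrams *)

Section subdiagram_approximation.
Variables (B : bratteli) (S : subdiagram B).

Definition sub_prefix n : set (inf_path B) :=
  [set x : inf_path B | forall i, (i < n)%N -> x i \in subE S i].

Lemma clopen_sub_prefix n : clopen (sub_prefix n).
Proof. by apply: (@clopen_prefix _ n) => x y xy xS i im; rewrite xy// xS. Qed.

Lemma sub_prefix_nonincreasing : nonincreasing_seq sub_prefix.
Proof.
move=> n k nk; apply/subsetPset => x xS i im; apply: xS.
exact: leq_trans nk.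
Qed.

Lemma bigcap_sub_prefix : \bigcap_n sub_prefix n = sub_paths S.
Proof.
apply/seteqP; split => x xS; last by move=> n _ i _; exact: xS.
by move=> i; exact: (xS i.+1).
Qed.

End subdiagram_approximation.

Lemma measurable_hat_preimage (B : bratteli) (S : subdiagram B)
    (A : set (inf_path B)) :
  clopen A -> measurable (hat_val S @^-1` A : set (borel (hat_space S))).
Proof. by move=> [oA _]; apply: sub_sigma_algebra; exists A. Qed.

Local Open Scope ereal_scope.

Theorem corollary4p7 (R : realType) (B : bratteli) (S : subdiagram B)
    (cantorB : cantor_like (inf_path B))
    (thinS : thin R S)
    (mu : probability (borel (sub_space S)) R)
    (mu_inv : sub_invariant mu)
    (nu : {measure set (borel (hat_space S)) -> \bar R})
    (nu_ext : hat_extension mu nu) :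
  nu [set: hat_space S] = +oo.
Proof.
have nu_sub : nu (hat_val S @^-1` sub_paths S) = 1.
  have := hat_extends nu_ext (@measurableT _ (borel (inf_path B))).
  rewrite setTI preimage_setT => h; apply: etrans h _; exact: probability_setT.
apply/eqP; rewrite -leye_eq leNgt; apply/negP => nu_fin.
pose c := fine (nu setT).
have nuT : nu setT = c%:E by rewrite fineK// ge0_fin_numE.
have mK n : measurable
    (hat_val S @^-1` sub_prefix S n : set (borel (hat_space S))).
  by apply: measurable_hat_preimage; exact: clopen_sub_prefix.
have nu_le1 n : 1 <= nu (hat_val S @^-1` sub_prefix S n).
  rewrite -nu_sub; apply: le_measure; rewrite ?inE.
  - rewrite -bigcap_sub_prefix preimage_bigcap.
    by apply: bigcapT_measurable => k; exact: mK.
  - exact: mK.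
  - by rewrite -bigcap_sub_prefix => x xS; exact: (xS n I).
have nu_num A : clopen A -> nu (hat_val S @^-1` A) \is a fin_num.
  move=> cA; rewrite ge0_fin_numE//; apply: le_lt_trans nu_fin.
  by apply: le_measure; rewrite ?inE//; exact: measurable_hat_preimage.
have c_gt0 : (0 < c)%R.
  rewrite -lte_fin -nuT; apply: lt_le_trans lte01 (le_trans (nu_le1 0%N) _).
  by apply: le_measure; rewrite ?inE//; exact: mK.
pose m0 A := (fine (nu (hat_val S @^-1` A)) / c)%R.
have m0M : tail_content m0.
  split; first split.
  - by move=> A cA; rewrite divr_ge0 ?fine_ge0// ltW.
  - by rewrite /m0 preimage_setT nuT divff// gt_eqF.
  - move=> A C cA cC AC0; rewrite /m0 preimage_setU measureU.
    + by rewrite fineD ?mulrDl//; exact: nu_num.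
    + exact: measurable_hat_preimage.
    + exact: measurable_hat_preimage.
    + by rewrite -preimage_setI AC0 preimage_set0.
  - by move=> n v f g fv gv; rewrite /m0 (hat_extension_invariant nu_ext fv gv).
have m0K n : (c^-1 <= m0 (sub_prefix S n))%R.
  rewrite -[leLHS]mul1r ler_pM2r ?invr_gt0// -lee_fin fineK//.
  by apply: nu_num; exact: clopen_sub_prefix.
have [_ compactX _ _] := cantorB.
have [P [P_inv P_erg]] := ergodic_exists compactX m0M (@clopen_sub_prefix _ S)
  (@sub_prefix_nonincreasing _ S) m0K.
have PS0 : P (sub_paths S) = 0 := thinS P P_inv P_erg.
rewrite bigcap_sub_prefix PS0 lee_fin leNgt.
by rewrite invr_gt0 c_gt0.
Qed.
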